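(* Let $n\ge2$ and $0\le k\le n-1$. The following numbers are all equal: (0) the number of NBC bases of activity $k$ of the Shi gain graph $S_n=K_n^{[0,1]}$; (1) the number of rooted labeled trees on $[n]$ in which vertex $n$ has exactly $k$ children (i.e., exactly $k$ edges of the form $(n,i)$); (2) the number of rooted labeled trees on $[n]$ having exactly $k$ edges of the form $(i+1,i)$ (edges whose parent is $i+1$ and whose child is $i$); (3) $\binom{n-1}{k}(n-1)^{n-1-k}$.
   Context: $K_n^{[0,1]}$ is the gain graph on $[n]$ with, for each $1\le i<j\le n$, two edges from $i$ to $j$ with gains $0$ and $1$ (hyperplanes $x_j-x_i=0$ and $x_j-x_i=1$); traversed backwards an edge of gain $g$ has gain $-g$. A circle is balanced if its gain sum in a fixed direction is $0$. Fix a linear order on the edges; a broken circuit is a balanced circle minus its smallest edge; an NBC set is an edge set forming a forest of the underlying multigraph (no circles, no two parallel edges) containing no broken circuit; an NBC basis is an NBC set which is a spanning tree. For an NBC basis $B$, $e\in B$ is active if $e$ is the smallest edge among all edges $f$ such that $(B\setminus\{e\})\cup\{f\}$ is a spanning tree; the activity of $B$ is the number of its active edges (these counts do not depend on the order). A rooted labeled tree on $[n]$ is a spanning tree on vertex set $[n]$ with a distinguished root, edges directed from parent to child. *)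

(* Defs.v *)
From mathcomp Require Import all_boot all_order all_algebra.
Set Implicit Arguments. Unset Strict Implicit. Unset Printing Implicit Defensive.
Import GRing.Theory Num.Theory.

(* Vertices [n] = {1,..,n} are represented by 'I_n (label i+1 <-> ordinal i).
   An edge is a triple (i, j, g) with i < j and g : bool; it is the edge from
   i to j with gain g (0 or 1), i.e. the hyperplane x_j - x_i = g. *)
Definition edge (n : nat) := ('I_n * 'I_n * bool)%type.

Definition valid_edge n (e : edge n) : bool := (e.1.1 < e.1.2)%N.
Definition etail n (e : edge n) : 'I_n := e.1.1.
Definition ehead n (e : edge n) : 'I_n := e.1.2.
Definition egain n (e : edge n) : int := Posz (nat_of_bool e.2).

Definition joins n (e : edge n) (a b : 'I_n) : bool :=
  ((etail e == a) && (ehead e == b)) || ((etail e == b) && (ehead e == a)).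

Definition dgain n (e : edge n) (a : 'I_n) : int :=
  if etail e == a then egain e else (- egain e)%R.

(* A closed walk  v_0 -c_0- v_1 -c_1- ... v_{m+1} -c_{m+1}- v_0  with distinct
   vertices and distinct (valid) edges, of length m+2 >= 2. *)
Definition circle_walk n m (v : {ffun 'I_m.+2 -> 'I_n})
    (c : {ffun 'I_m.+2 -> edge n}) : bool :=
  injectiveb v && injectiveb c &&
  [forall t, valid_edge (c t) && joins (c t) (v t) (v (ordS t))].

Definition is_circle n (C : {set edge n}) : bool :=
  [exists m : 'I_n, exists v : {ffun 'I_m.+2 -> 'I_n},
    exists c : {ffun 'I_m.+2 -> edge n},
      circle_walk v c && (C == [set c t | t : 'I_m.+2])].

Definition balanced_circle n (C : {set edge n}) : bool :=
  [exists m : 'I_n, exists v : {ffun 'I_m.+2 -> 'I_n},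
    exists c : {ffun 'I_m.+2 -> edge n},
      [&& circle_walk v c, (C == [set c t | t : 'I_m.+2]) &
          (\sum_(t < m.+2) dgain (c t) (v t) == 0)%R]].

(* The linear order on edges is given by an injective ranking ord. *)
Definition broken_circuit n (ord : edge n -> nat) (B : {set edge n}) : bool :=
  [exists C : {set edge n}, balanced_circle C &&
    [exists e in C, [forall f in C, ord e <= ord f] && (B == C :\ e)]].

(* forest of the underlying multigraph: edges of S_n, no circle
   (circles of length 2 are pairs of parallel edges) *)
Definition forest n (S : {set edge n}) : bool :=
  [forall e in S, valid_edge e] &&
  ~~ [exists C : {set edge n}, (C \subset S) && is_circle C].

Definition adj n (S : {set edge n}) : rel 'I_n :=
  fun x y => [exists e in S, joins e x y].

Definition spanning_tree n (S : {set edge n}) : bool :=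
  forest S && [forall x, forall y, connect (adj S) x y].

Definition nbc_set n (ord : edge n -> nat) (S : {set edge n}) : bool :=
  forest S &&
  ~~ [exists B : {set edge n}, broken_circuit ord B && (B \subset S)].

Definition nbc_basis n (ord : edge n -> nat) (B : {set edge n}) : bool :=
  nbc_set ord B && spanning_tree B.

Definition active n (ord : edge n -> nat) (B : {set edge n}) (e : edge n) : bool :=
  (e \in B) &&
  [forall f, (valid_edge f && spanning_tree ((B :\ e) :|: [set f])) ==>
             (ord e <= ord f)].

Definition activity n (ord : edge n -> nat) (B : {set edge n}) : nat :=
  #|[set e | active ord B e]|.

(* A rooted labeled tree is encoded by its root r and its parent map par:
   par r = r and every vertex reaches r by iterating par.  Its edges, directed
   from parent to child, are the pairs (par v, v) for v <> r. *)
Definition rooted_tree n (r : 'I_n) (par : {ffun 'I_n -> 'I_n}) : bool :=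
  (par r == r) && [forall v, connect (frel par) v r].

Definition rtree_edges n (r : 'I_n) (par : {ffun 'I_n -> 'I_n}) :
    {set 'I_n * 'I_n} :=
  [set (par v, v) | v in [set v | v != r]].

(* Main.v *)
Require Import Defs.
From mathcomp Require Import all_boot all_order all_algebra.
Set Implicit Arguments. Unset Strict Implicit. Unset Printing Implicit Defensive.
Import Order.TTheory GRing.Theory Num.Theory.

(** Each of the three statistics satisfies
    [\sum_o ('X + 1) ^+ stat o = ('X + n) ^+ n.-1]; replacing ['X] by ['X - 1]
    and comparing coefficients gives the common value.

    Rooted trees: both statistics count the edges shared with a fixed rooted
    tree [F] (the star at [n], resp. the path rooted at [n]).  Expanding
    [('X + 1) ^+ stat] over sets of shared edges reduces the identity to the
    fact that a rooted forest with [k + 1] components lies in [n ^ k] rooted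
    trees.

    NBC bases: every NBC set [S] is [B :\: A] for a unique NBC basis [B] and a
    unique set [A] of active edges of [B], [B] being the spanning tree of least
    weight that contains [S].  Hence the sum equals
    [\sum_(S NBC) 'X^(n.-1 - #|S|)].  At ['X = - q] this is, by Whitney's
    theorem, up to sign and a factor [q] the number of [x] in [(Z/q)^n] with
    [x_j - x_i] different from [0] and [1] for [i < j], namely
    [q * (q - n) ^ n.-1]. *)

(** * Generating polynomials *)

Section Statistic.
Local Open Scope ring_scope.

(** The power is expanded as a product over all of [T] whose factors outside [A] are [0 + 1], so
    that only subsets of [A] survive. *)
Lemma sum_subset_expr (R : comPzRingType) (T : finType) (A : {set T}) (x y : R) :
  \sum_(J : {set T} | J \subset A) x ^+ #|J| * y ^+ (#|A| - #|J|)
  = (x + y) ^+ #|A|.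
Proof.
rewrite -[in RHS]prodr_const [RHS]big_mkcond /=.
transitivity (\prod_i ((if i \in A then x else 0) + (if i \in A then y else 1))); last first.
  by apply: eq_bigr => i _; case: ifP; rewrite ?add0r.
rewrite bigA_distr /= [LHS]big_mkcond; apply: eq_bigr => J _ /=.
case: ifPn => [sJA | /subsetPn [i iJ iA]]; last first.
  by rewrite (bigD1 i) //= iJ (negbTE iA) mul0r.
rewrite -cardsDS // -!prodr_const [X in X * _]big_mkcond [X in _ * X]big_mkcond.
rewrite -big_split; apply: eq_bigr => i _ /=; rewrite inE.
by case: (boolP (i \in J)) => [/(subsetP sJA) ->|_] /=; rewrite ?mulr1 ?mul1r.
Qed.

Lemma sum_Xn_subset (T : finType) (A : {set T}) :
  \sum_(J : {set T} | J \subset A) 'X^#|J| = ('X + 1) ^+ #|A| :> {poly int}.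
Proof.
by rewrite -sum_subset_expr; apply: eq_bigr => J _; rewrite expr1n mulr1.
Qed.

Lemma card_statistic (T : finType) (P : pred T) (stat : T -> nat) (m c k : nat) :
  \sum_(o | P o) ('X + 1) ^+ stat o = ('X + c.+1%:R) ^+ m :> {poly int} ->
  (k <= m)%N ->
  #|[set o | P o && (stat o == k)]| = ('C(m, k) * c ^ (m - k))%N.
Proof.
move=> gf lekm.
have := congr1 (fun p : {poly int} => (p \Po ('X - 1))`_k) gf.
rewrite rmorph_sum /= coef_sum.
under eq_bigr => o _ do rewrite rmorphXn /= comp_polyD comp_polyX comp_polyC subrK coefXn mulrb.
rewrite -big_mkcondr /=.
rewrite rmorphXn /= comp_polyD comp_polyX -polyC_natr comp_polyC.
have -> : 'X - 1 + c.+1%:R%:P = c%:R%:P + 'X :> {poly int}.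
  rewrite -addrA addrC; congr (_ + _).
  by rewrite -natr1 polyCD polyC1 addrC addrK.
rewrite exprDn coef_sum (bigD1 (inord k)) //= inordK ?ltnS //.
rewrite coefMn -polyC_exp coefCM coefXn eqxx mulr1 [X in _ + X]big1 ?addr0; last first.
  move=> i /eqP ik; rewrite coefMn -polyC_exp coefCM coefXn.
  case: eqP => [E|]; last by rewrite mulr0 mul0rn.
  by case: ik; apply: val_inj; rewrite /= inordK ?ltnS // E.
under eq_bigl => o do rewrite eq_sym.
rewrite sumr_const -natrX -mulrnA => /eqP.
rewrite eqr_nat mulnC => /eqP <-; rewrite cardsE; apply: eq_card => o.
by rewrite unfold_in /= eq_sym.
Qed.

(** Otherwise the nonzero difference would have as many distinct roots as its size, which exceeds
    its degree. Negative points are used because counting colourings with [m] colours gives the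
    values at [- m]. *)
Lemma poly_eq_nat_evals (p q : {poly int}) (b : nat) :
  (forall m, (b <= m)%N -> p.[- m%:R] = q.[- m%:R]) -> p = q.
Proof.
move=> pq; apply/eqP; rewrite -subr_eq0; apply/negPn/negP => nz.
pose s : seq int := [seq - m%:R | m <- iota b (size (p - q))].
have := @max_poly_roots _ (p - q) s nz.
rewrite size_map size_iota ltnn => H; apply: notF; apply: H.
  apply/allP => x /mapP [m]; rewrite mem_iota => /andP [bm _] ->.
  by rewrite rootE hornerD hornerN pq // subrr.
by rewrite map_inj_uniq ?iota_uniq // => x y /oppr_inj /eqP; rewrite eqr_nat => /eqP.
Qed.

End Statistic.

(** * Rooted forests and trees *)

Section RootedForests.

Variable T : finType.
Implicit Types (F G : {ffun T -> T}) (u v c p : T).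

(** Forests are encoded by parent maps whose fixed points are the roots. *)
Definition roots_of F := [set v | F v == v].

Definition root_of F v := iter #|T| F v.

Definition rforest F := [forall v, root_of F v \in roots_of F].

Definition rtree F := rforest F && (#|roots_of F| == 1).

Definition extends G F := [forall v, (F v != v) ==> (G v == F v)].

Definition graft F c p := [ffun v => if v == c then p else F v].

Lemma iter_root F v m k :
  iter m F v \in roots_of F -> m <= k -> iter k F v = iter m F v.
Proof.
rewrite inE => /eqP fixm /subnK <-; rewrite iterD.
by elim: (k - m) => //= j ->.
Qed.

Lemma root_ofE F v m : iter m F v \in roots_of F -> root_of F v = iter m F v.
Proof.
move=> fixm; rewrite -(iter_findex (fconnect_iter F m v)) /root_of.
apply: iter_root; first by rewrite iter_findex ?fconnect_iter.
apply: leq_trans (ltnW (findex_max (fconnect_iter F m v))) _; exact: max_card.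
Qed.

Lemma rforestP F :
  reflect (forall v, exists m, iter m F v \in roots_of F) (rforest F).
Proof.
apply: (iffP forallP) => [frF v | frF v]; first by exists #|T|; apply: frF.
by have [m fixm] := frF v; rewrite (root_ofE fixm).
Qed.

(** Going round the cycle often enough outlasts the time at which the orbit settles on a root, so
    [v] is that root. *)
Lemma rforest_periodic F v m : rforest F -> iter m.+1 F v = v -> F v = v.
Proof.
move=> /rforestP /(_ v) [k fixk] per.
have perj j : iter (j * m.+1) F v = v by elim: j => // j IH; rewrite mulSn iterD IH.
have := fixk; rewrite -(iter_root fixk (leq_pmulr k (ltn0Sn m))) perj.
by rewrite inE => /eqP.
Qed.

Lemma extendsP G F : reflect (forall v, F v != v -> G v = F v) (extends G F).
Proof.
by apply: (iffP forallP) => H v; [move=> nv; have := H v; rewrite nv => /eqP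
  | apply/implyP => nv; rewrite H].
Qed.

Lemma roots_extends G F : extends G F -> roots_of G \subset roots_of F.
Proof.
move/extendsP=> ext; apply/subsetP => v; rewrite !inE => Gv.
by apply/negPn/negP => nv; have := nv; rewrite -{1}(ext v nv) Gv.
Qed.

Lemma iter_extends G F v m : extends G F ->
  iter m F v \in roots_of F \/ iter m G v = iter m F v.
Proof.
move/extendsP=> ext; elim: m => [|m IH]; first by right.
case: (boolP (iter m F v \in roots_of F)) => [fixm | nfix].
  by left; rewrite (iter_root fixm (leqnSn m)).
case: IH => [|E]; first by rewrite (negbTE nfix).
by right; rewrite !iterS E ext //; rewrite inE in nfix.
Qed.

Lemma rforest_extends G F : rforest G -> extends G F -> rforest F.
Proof.
move=> frG ext; apply/forallP => v.
have [//|E] := iter_extends v #|T| ext.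
by apply: (subsetP (roots_extends ext)); rewrite /root_of -E; apply: (forallP frG).
Qed.

(** Up to the first arrival at a root of [F], every vertex on the path has a parent in [F], and [G]
    keeps that parent. *)
Lemma root_of_extends G F v : rforest F -> extends G F ->
  exists m, iter m G v = root_of F v.
Proof.
move=> frF ext.
have [m fixm min] := ex_minnP (rforestP _ frF v); exists m.
rewrite (root_ofE fixm); case: m => // m in fixm min *.
have [H|E] := iter_extends v m ext; first by have := min _ H; rewrite ltnn.
rewrite !iterS E; apply: (extendsP _ _ ext).
by apply/negP => H; have := min m; rewrite inE H ltnn => /(_ isT).
Qed.

Lemma rforest_graft F c p :
  rforest F -> c \in roots_of F -> root_of F p != c -> rforest (graft F c p).
Proof.
move=> frF; rewrite inE => /eqP fixc rp.
(* A path in a component other than that of [c] never meets [c], so the graft leaves it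
   unchanged. *)
have same v : root_of F v != c ->
    forall m, iter m (graft F c p) v = iter m F v /\ iter m F v != c.
  move=> rv; elim=> [|m [IH nc]].
    by split=> //; apply: contraNneq rv => /= ->; rewrite (@root_ofE F c 0) //= inE fixc.
  rewrite !iterS IH ffunE (negbTE nc); split=> //.
  apply: contraNneq rv => E; have E' : iter m.+1 F v = c by [].
  by rewrite (@root_ofE F v m.+1) E' // inE fixc.
have ok v : root_of F v != c -> exists m, iter m (graft F c p) v \in roots_of (graft F c p).
  move=> rv; have [m fixm] := rforestP _ frF v; exists m.
  have [-> nc] := same v rv m.
  by move: fixm; rewrite !inE ffunE (negbTE nc).
apply/rforestP => v.
case: (boolP (root_of F v == c)) => [/eqP rv | /ok //].
(* In the component of [c], the path is unchanged up to its first visit [m0] to [c]; the next vertex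
   is [p], for which the previous case applies. *)
have [m0 m0c min] := ex_minnP (ex_intro (fun m => iter m F v == c) #|T| (introT eqP rv)).
have E m : m <= m0 -> iter m (graft F c p) v = iter m F v.
  elim: m => // m IH lt; rewrite !iterS IH ?(ltnW lt) // ffunE.
  by case: eqP => // Ec; have := min m; rewrite Ec eqxx leqNgt lt => /(_ isT).
have [m fixm] := ok p rp; exists (m + m0.+1).
by rewrite iterD iterS E // (eqP m0c) ffunE eqxx.
Qed.

Lemma roots_graft F c p : p != c -> roots_of (graft F c p) = roots_of F :\ c.
Proof.
move=> pc; apply/setP => v; rewrite !inE ffunE.
by case: (eqVneq v c) => [->|//]; rewrite (negbTE pc).
Qed.

(** Two readings of a triple [(G, c, p)]: a tree [G] with an edge into a root [c] of [F], or an
    admissible graft together with a tree extending it. If [p] lay in the component of [c], [G]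
    would have a cycle through [c]. *)
Lemma extends_graft F G c p : rforest F ->
  [&& rtree G && extends G F, (c \in roots_of F) && (c \notin roots_of G) & p == G c]
  = ((c \in roots_of F) && (root_of F p != c)) && (rtree G && extends G (graft F c p)).
Proof.
move=> frF; case: (boolP (c \in roots_of F)) => rc /=; last by rewrite andbF.
have rcc : root_of F c = c by rewrite (@root_ofE _ _ 0).
case: (boolP (rtree G)) => /= trG; last by rewrite andbF.
apply/and3P/andP => [[ext rGc /eqP Ep] | [rp /extendsP ext]].
  split.
    apply/eqP => rp; have [m Em] := root_of_extends p frF ext.
    move: rGc; rewrite inE (@rforest_periodic G c m) ?eqxx //; first by case/andP: trG.
    by rewrite iterSr -Ep Em.
  apply/extendsP => v; rewrite ffunE; case: (eqVneq v c) => [-> _ | _ ]; first by rewrite Ep.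
  exact: (extendsP _ _ ext).
have pc : p != c by apply: contraNneq rp => ->; rewrite rcc.
have Gc : G c = p by rewrite ext ffunE eqxx.
split; last by rewrite Gc.
  apply/extendsP => v nv.
  have vc : v != c by apply: contraNneq nv => ->; rewrite inE in rc.
  by rewrite ext ffunE (negbTE vc).
by rewrite inE Gc.
Qed.

(* Pitman's double counting: build the tree one edge at a time, grafting a root
   of the current forest onto any vertex of another component. *)
Lemma card_rtree_extends F k : rforest F -> #|roots_of F| = k.+1 ->
  #|[set G | rtree G && extends G F]| = #|T| ^ k.
Proof.
elim: k F => [|k IH] F frF cardF.
  have /cards1P [r Er] : #|roots_of F| == 1 by rewrite cardF.
  rewrite (_ : [set _ | _] = [set F]) ?cards1 //.
  apply/setP => G; rewrite !inE; apply/andP/eqP => [[/andP [_ cG] ext] | ->]; last first.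
    by rewrite /rtree frF cardF eqxx; split=> //; apply/extendsP.
  have EG : roots_of G = roots_of F.
    by apply/eqP; rewrite eqEcard roots_extends // cardF (eqP cG).
  apply/ffunP => v; case: (eqVneq (F v) v) => [Ev | nv]; last exact: (extendsP _ _ ext).
  have : v \in roots_of G by rewrite EG inE Ev.
  by rewrite inE Ev => /eqP.
set S := [set G | _].
(* The triples counted by tree: all of the [k.+2] roots of [F] but one have a parent in [G], and [p]
   is forced. *)
have L : \sum_G \sum_c \sum_p ([&& rtree G && extends G F,
      (c \in roots_of F) && (c \notin roots_of G) & p == G c] : nat) = #|S| * k.+1.
  rewrite -sum_nat_const [RHS]big_mkcond; apply: eq_bigr => G _; rewrite inE.
  case: ifPn => /= [/andP [/andP [_ cG] ext] | _]; last first.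
    by rewrite big1 // => c _; rewrite big1.
  transitivity (\sum_c (c \in roots_of F :\: roots_of G : nat)).
    apply: eq_bigr => c _; rewrite in_setD andbC; case: (_ && _) => /=; last by rewrite big1.
    by rewrite (bigD1 (G c)) //= eqxx big1 // => p /negbTE ->.
  by rewrite -big_mkcond /= sum1_card cardsDS ?roots_extends // cardF (eqP cG).
(* The triples counted by graft: any [p], then any of the [k.+1] roots other than its own, then the
   induction hypothesis. *)
have R : \sum_G \sum_c \sum_p (((c \in roots_of F) && (root_of F p != c)) &&
      (rtree G && extends G (graft F c p)) : nat) = #|T| * (k.+1 * #|T| ^ k).
  rewrite exchange_big /=.
  transitivity (\sum_c \sum_p (if (c \in roots_of F) && (root_of F p != c)
      then #|T| ^ k else 0)).
    apply: eq_bigr => c _; rewrite exchange_big /=; apply: eq_bigr => p _.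
    case: ifPn => [/andP [rc rp] | _] /=; last by rewrite big1.
    rewrite -(IH (graft F c p)) ?rforest_graft //; last first.
      rewrite roots_graft; last first.
        apply: contraNneq rp => ->; rewrite (@root_ofE _ _ 0) //.
      by have := cardsD1 c (roots_of F); rewrite rc cardF => -[].
    by rewrite -sum1dep_card [RHS]big_mkcond; apply: eq_bigr => G _; case: ifP.
  rewrite exchange_big /= -sum_nat_const; apply: eq_bigr => p _.
  rewrite -big_mkcond /= sum_nat_const; congr (_ * _).
  rewrite (eq_card (B := roots_of F :\ root_of F p)); last first.
    by move=> c; rewrite unfold_in /= in_setD1 andbC eq_sym.
  have := cardsD1 (root_of F p) (roots_of F).
  by rewrite (forallP frF) cardF => -[].
have E : #|S| * k.+1 = #|T| * (k.+1 * #|T| ^ k).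
  rewrite -L -R; apply: eq_bigr => G _; apply: eq_bigr => c _; apply: eq_bigr => p _.
  by rewrite extends_graft.
by apply/eqP; rewrite -(@eqn_pmul2l k.+1) // mulnC E expnS mulnCA.
Qed.

End RootedForests.

Section CommonEdges.
Local Open Scope ring_scope.

Lemma rtree_common_edges (T : finType) (F : {ffun T -> T}) : rtree F ->
  \sum_(G : {ffun T -> T} | rtree G)
     ('X + 1) ^+ #|[set v | (F v != v) && (G v == F v)]|
  = ('X + #|T|%:R) ^+ #|T|.-1 :> {poly int}.
Proof.
case/andP=> frF /eqP cardF.
pose St (G : {ffun T -> T}) := [set v | (F v != v) && (G v == F v)].
(* An edge of [F] is named by its child: [D] stands for the edge set of [F], and [FA A] is the
   subforest with edge set [A]. *)
pose D := ~: roots_of F.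
have cardD : #|D| = #|T|.-1 by rewrite -(cardsC (roots_of F)) cardF.
pose FA (A : {set T}) := [ffun v => if v \in A then F v else v] : {ffun T -> T}.
transitivity (\sum_(G : {ffun T -> T} | rtree G)
    \sum_(A : {set T} | A \subset D) if A \subset St G then 'X^#|A| : {poly int} else 0).
  apply: eq_bigr => G _; rewrite -sum_Xn_subset -big_mkcondr /=; apply: eq_bigl => A.
  apply/idP/andP => [sA | [] //]; split=> //; apply: subset_trans sA _.
  by apply/subsetP => v; rewrite !inE => /andP [].
rewrite exchange_big -cardD -sum_subset_expr /=; apply: eq_bigr => A sAD.
rewrite -big_mkcondr sumr_const /= -[LHS]mulr_natr; congr (_ * _).
rewrite -natrX; congr (_%:R).
have rootsFA : roots_of (FA A) = ~: A.
  apply/setP => v; rewrite !inE ffunE; case: ifPn => [vA|_]; last exact: eqxx.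
  by have := subsetP sAD v vA; rewrite !inE => /negbTE.
have extF : extends F (FA A).
  by apply/extendsP => v; rewrite ffunE; case: ifP => //; rewrite eqxx.
rewrite -(@card_rtree_extends T (FA A) (#|D| - #|A|)).
- rewrite cardsE; apply: eq_card => G; rewrite !unfold_in /=; congr (_ && _).
  apply/subsetP/extendsP => [sA v | ext v vA].
    rewrite ffunE; case: ifP => [vA _|]; last by rewrite eqxx.
    by have := sA v vA; rewrite inE => /andP [_ /eqP].
  have nv : F v != v by have := subsetP sAD v vA; rewrite !inE.
  by rewrite inE nv ext ffunE vA ?eqxx.
- exact: rforest_extends frF extF.
rewrite rootsFA -subSn ?subset_leq_card // cardD prednK; last first.
  by rewrite -(cardsC (roots_of F)) cardF.
by rewrite -(cardsC A) addKn.
Qed.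

End CommonEdges.

(** * Labeled trees counted by their edges in common with a fixed tree *)

Section LabeledTrees.

Variable n : nat.
Implicit Types (r v : 'I_n) (par : {ffun 'I_n -> 'I_n}).

(** The root is recovered as the only fixed point of the parent map, so counting pairs amounts to
    counting maps. *)
Lemma rooted_treeE r par :
  rooted_tree r par = rtree par && (roots_of par == [set r]).
Proof.
apply/andP/andP => [[/eqP fixr /forallP conn] | [/andP [frp _] /eqP Er]].
  have rp : r \in roots_of par by rewrite inE fixr.
  have root_r v : root_of par v = r.
    by rewrite -(iter_findex (conn v)); apply: root_ofE; rewrite iter_findex.
  have Er : roots_of par = [set r].
    apply/setP => v; apply/idP/idP => [fixv | /set1P -> //].
    by rewrite inE -(root_r v) (@root_ofE _ _ _ 0).
  split; last by rewrite Er.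
  by rewrite /rtree Er cards1 eqxx andbT; apply/forallP => v; rewrite root_r Er set11.
have fixr : r \in roots_of par by rewrite Er set11.
split; first by rewrite inE in fixr.
apply/forallP => v; have := forallP frp v; rewrite Er => /set1P <-.
exact: fconnect_iter.
Qed.

Lemma card_rooted_tree (P : pred {ffun 'I_n -> 'I_n})
    (Q : pred ('I_n * {ffun 'I_n -> 'I_n})) :
  (forall r par, rooted_tree r par -> Q (r, par) = P par) ->
  #|[set rp | rooted_tree rp.1 rp.2 && Q rp]| = #|[set par | rtree par && P par]|.
Proof.
move=> QP; rewrite -(@card_in_imset _ _ snd) => [|[r1 p1] [r2 p2]]; last first.
  rewrite !inE /= !rooted_treeE => /andP [/andP [_ /eqP E1] _] /andP [/andP [_ /eqP E2] _] E.
  by rewrite E -E in E1 E2 *; congr (_, _); apply: set1_inj; rewrite -E1 -E2.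
apply: eq_card => par; rewrite inE; apply/imsetP/andP => [[[r p]] | [trp Pp]].
  rewrite inE /= => /andP [rt Qp] ->; split; last by rewrite -(QP r).
  by move: rt; rewrite rooted_treeE => /andP [].
have /andP [_ /cards1P [r Er]] := trp.
have rt : rooted_tree r par by rewrite rooted_treeE trp Er eqxx.
by exists (r, par); rewrite // inE rt QP.
Qed.

Lemma card_rtree_edges r par (Q : pred ('I_n * 'I_n)) :
  #|[set e in rtree_edges r par | Q e]| = #|[set v | (v != r) && Q (par v, v)]|.
Proof.
rewrite -(@card_imset _ _ (fun v => (par v, v))) => [|u v [] //].
apply: eq_card => e; rewrite !inE; apply/andP/imsetP => [[/imsetP [v]] | [v]].
  by rewrite inE => vr -> Qv; exists v; rewrite // inE vr.
by rewrite inE => /andP [vr Qv] ->; split=> //; apply/imsetP; exists v; rewrite ?inE.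
Qed.

Lemma card_rooted_tree_common_edges (F : {ffun 'I_n -> 'I_n})
    (Q : pred ('I_n * 'I_n)) (k : nat) :
    rtree F -> (k <= n.-1)%N ->
    (forall p v, p != v -> Q (p, v) = (F v != v) && (p == F v)) ->
  #|[set rp : 'I_n * {ffun 'I_n -> 'I_n} | rooted_tree rp.1 rp.2 &&
       (#|[set e in rtree_edges rp.1 rp.2 | Q e]| == k)]|
  = ('C(n.-1, k) * n.-1 ^ (n.-1 - k))%N.
Proof.
move=> trF lek QF.
have n_gt0 : (0 < n)%N.
  by case/andP: trF => _ /cards1P [r _]; apply: leq_ltn_trans (ltn_ord r).
rewrite (@card_rooted_tree
    (fun G => #|[set v | (F v != v) && (G v == F v)]| == k)); last first.
  move=> r par; rewrite rooted_treeE => /andP [_ /eqP Er] /=; rewrite card_rtree_edges.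
  congr (_ == _); apply: eq_card => v; rewrite !inE.
  have -> : (v != r) = (par v != v) by rewrite -in_set1 -Er inE.
  case: (eqVneq (par v) v) => [-> /=|nv]; first by case: eqVneq.
  by rewrite QF.
apply: card_statistic => //.
by rewrite (rtree_common_edges trF) card_ord prednK.
Qed.

End LabeledTrees.

Lemma rtree_star (n : nat) : rtree ([ffun => ord_max] : {ffun 'I_n.+1 -> 'I_n.+1}).
Proof.
set F := (X in rtree X).
have Er : roots_of F = [set ord_max] by apply/setP => v; rewrite !inE ffunE eq_sym.
rewrite /rtree Er cards1 eqxx andbT; apply/rforestP => v.
by exists 1; rewrite Er /= ffunE set11.
Qed.

(** The cap [minn] makes the last vertex its own parent; [m] steps from [v] lead to [v + m], capped
    at [n]. *)
Lemma rtree_path (n : nat) :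
  rtree ([ffun v : 'I_n.+1 => inord (minn v.+1 n)] : {ffun 'I_n.+1 -> 'I_n.+1}).
Proof.
set F := (X in rtree X).
have valF v : F v = minn v.+1 n :> nat by rewrite ffunE inordK // ltnS geq_minr.
have Er : roots_of F = [set ord_max].
  apply/setP => v; rewrite !inE -!val_eqE /= valF.
  have := ltn_ord v; rewrite ltnS; case: ltngtP => // [lt|->] _.
    by rewrite (minn_idPl lt) gtn_eqF.
  by rewrite (minn_idPr (leqnSn n)) eqxx.
rewrite /rtree Er cards1 eqxx andbT; apply/rforestP => v.
exists n; rewrite Er inE -val_eqE /=; apply/eqP.
have it m : iter m F v = minn (v + m) n :> nat.
  elim: m => [|m IH]; first by rewrite addn0; symmetry; apply/minn_idPl; rewrite -ltnS.
  rewrite iterS valF IH addnS; have [//|lt] := leqP (v + m) n.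
  by rewrite !(minn_idPr _) // ltnW // ltnS ltnW.
by rewrite it; apply/minn_idPr; rewrite leq_addl.
Qed.

(** * Colourings of the Shi gain graph *)

Lemma card_ord_lt (q m : nat) : m <= q -> #|[set s : 'I_q | s < m]| = m.
Proof.
move=> lemq; rewrite -sum1dep_card -(big_ord_widen q (fun=> 1) lemq).
by rewrite sum1_card card_ord.
Qed.

Lemma Zp_succE (p : nat) (a b : 'I_p.+2) :
  b != 0%R -> (b == (a + 1)%R) = (b == a.+1 :> nat).
Proof.
rewrite -!val_eqE /= [1 %% _]modn_small // addn1 => b0.
have := ltn_ord a; rewrite leq_eqVlt => /orP [/eqP E|lt].
  rewrite E modnn (negbTE b0); apply/esym/negbTE.
  by rewrite neq_ltn (ltn_ord b).
by rewrite modn_small.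
Qed.

(* The [n'.+1] vertices sit on a cycle of [q] seats, of which [d'.+1] stay
   vacant.  In a run of consecutive occupied seats the labels must decrease, so
   once the cycle is cut at a vacant seat a proper colouring amounts to choosing,
   for each vertex, one of the [d'.+1] gaps between vacant seats. *)
Section Seating.

Variables n' d' : nat.
Local Notation n := n'.+1.
Local Notation q := (n' + d').+2.
Implicit Types (x : {ffun 'I_n -> 'I_q}) (f : {ffun 'I_n -> 'I_d'.+1}) (u v w : 'I_n).

Definition shi_proper x :=
  [forall i : 'I_n, forall j : 'I_n, (i < j) ==> (x j != x i) && (x j != (x i + 1)%R)].

Definition vacant x (s : 'I_q) := [forall v, x v != s].

Lemma shi_properP x :
  reflect (forall i j : 'I_n, i < j -> x j != x i /\ x j != (x i + 1)%R) (shi_proper x).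
Proof.
apply: (iffP forallP) => H i; last first.
  by apply/forallP => j; apply/implyP => /H [-> ->].
by move=> j lt; have /forallP/(_ j) := H i; rewrite lt => /andP.
Qed.

Lemma shi_proper_inj x : shi_proper x -> injective x.
Proof.
move/shi_properP=> px u v E; apply: val_inj; apply/eqP.
by case: ltngtP => // /px []; rewrite E eqxx.
Qed.

(** The seating order: by gap, and by decreasing label within a gap. *)
Definition below f w v := (f w < f v) || (f w == f v) && (v < w).

Lemma below_irr f v : below f v v = false.
Proof. by rewrite /below !ltnn andbF. Qed.

Lemma below_trans f : transitive (below f).
Proof.
move=> v u w; rewrite /below.
case/orP=> [lt1|/andP [/eqP -> lt1]]; case/orP=> [lt2|/andP [/eqP E2 lt2]].
- by rewrite (ltn_trans lt1 lt2).
- by rewrite -E2 lt1.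
- by rewrite lt2.
- by rewrite E2 eqxx (ltn_trans lt2 lt1) orbT.
Qed.

Lemma below_total f u v : u != v -> below f u v || below f v u.
Proof.
move=> uv; rewrite /below [f v == _]eq_sym -val_eqE.
case: ltngtP => //= _; rewrite -val_eqE /= in uv.
by rewrite orbC -neq_ltn.
Qed.

(** Before [v] come [(f v).+1] vacant seats, seat [0] among them, and the seats of the vertices
    below [v]. *)
Definition seat_nat f v := (f v + #|[set w | below f w v]|).+1.
Definition seat f : {ffun 'I_n -> 'I_q} := [ffun v => inord (seat_nat f v)].

Lemma seatE f v : seat f v = seat_nat f v :> nat.
Proof.
rewrite ffunE inordK // /seat_nat !ltnS.
rewrite addnC leq_add //; last by rewrite -ltnS.
have : [set w | below f w v] \subset [set~ v].
  by apply/subsetP => w; rewrite !inE; apply: contraTneq => ->; rewrite below_irr.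
by move/subset_leq_card; rewrite cardsC1 card_ord.
Qed.

(** Written without subtraction, the seats differ by at least [f v - f w + 1]: all vertices below
    [w] are below [v], and so is [w] itself. *)
Lemma seat_below f w v : below f w v -> f v + (seat_nat f w).+1 <= f w + seat_nat f v.
Proof.
move=> wv; rewrite /seat_nat !addnS !ltnS addnCA !ltn_add2l.
apply: proper_card; apply/properP; split.
  by apply/subsetP => u; rewrite !inE => /below_trans; apply.
by exists w; rewrite !inE ?below_irr.
Qed.

Lemma seat_lt f w v : (seat f w < seat f v) = below f w v.
Proof.
have lt u z : below f u z -> seat_nat f u < seat_nat f z.
  move=> uz; have le : f u <= f z by case/orP: uz => [/ltnW //|/andP [/eqP ->]].
  rewrite -(leq_add2l (f u)); apply: leq_trans (seat_below uz).
  by rewrite leq_add2r.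
rewrite !seatE; apply/idP/idP => [sw|/lt //].
case: (eqVneq w v) => [E|/(below_total f) /orP [//|/lt vw]].
  by rewrite E ltnn in sw.
by have := ltn_trans sw vw; rewrite ltnn.
Qed.

Lemma seat_vacant0 f : vacant (seat f) 0%R.
Proof. by apply/forallP => v; rewrite -val_eqE /= seatE. Qed.

Lemma seat_proper f : shi_proper (seat f).
Proof.
apply/shi_properP => i j lt.
have neq : i != j by rewrite -val_eqE /= ltn_eqF.
split.
  rewrite -val_eqE /= neq_ltn !seat_lt orbC; exact: below_total.
rewrite Zp_succE; last by apply: (forallP (seat_vacant0 f)).
(* Adjacent seats leave no room for a vacant one between them, so [i] and [j] share a gap, where the
   order of labels would force [j < i]. *)
rewrite !seatE; apply/eqP => E.
have ij : below f i j by rewrite -seat_lt !seatE E.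
have := seat_below ij; rewrite E leq_add2r => le.
have := ij; rewrite /below ltnNge le /= => /andP [_ lt'].
by have := ltn_trans lt lt'; rewrite ltnn.
Qed.

(** Comparing seats recovers [below], hence the number of vertices below [v]; what is left of the
    seat number gives [f v]. *)
Lemma seat_inj : injective seat.
Proof.
move=> f1 f2 E; apply/ffunP => v; apply: val_inj => /=.
have := congr1 (fun x : {ffun 'I_n -> 'I_q} => nat_of_ord (x v)) E.
rewrite /= !seatE /seat_nat => -[].
have -> : [set w | below f1 w v] = [set w | below f2 w v].
  by apply/setP => w; rewrite !inE -!seat_lt E.
by move/eqP; rewrite eqn_add2r => /eqP.
Qed.

Definition gaps x v := [set s : 'I_q | (s < x v) && vacant x s].

Lemma seat_gaps x v : injective x -> x v = #|gaps x v| + #|[set w | x w < x v]| :> nat.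
Proof.
move=> injx; rewrite -[LHS](@card_ord_lt q) ?(ltnW (ltn_ord _)) //.
rewrite -(cardsID [set s | vacant x s]); congr (_ + _).
  by apply: eq_card => s; rewrite !inE.
rewrite -(card_imset _ injx); apply: eq_card => s; rewrite !inE.
apply/andP/imsetP => [[/forallPn [w /negPn /eqP Ew] lt] | [w]].
  by exists w; rewrite // inE Ew.
rewrite inE => lt ->; split=> //; apply/forallPn; exists w.
by rewrite negbK.
Qed.

Lemma card_vacant x : injective x -> #|[set s | vacant x s]| = d'.+1.
Proof.
move=> injx; have -> : [set s | vacant x s] = ~: [set x v | v : 'I_n].
  apply/setP => s; rewrite !inE; apply/forallP/negP => [vs /imsetP [v _ E]|ns v].
    by have := vs v; rewrite E eqxx.
  by apply/eqP => E; case: ns; apply/imsetP; exists v.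
apply/eqP; rewrite -(eqn_add2l #|[set x v | v : 'I_n]|) cardsC card_imset //.
by rewrite !card_ord addSn addnS.
Qed.

Lemma gaps_bounds x v : injective x -> vacant x 0%R -> 0 < #|gaps x v| <= d'.+1.
Proof.
move=> injx v0; rewrite -(card_vacant injx) subset_leq_card ?andbT.
  apply/card_gt0P; exists 0%R; rewrite inE v0 andbT lt0n.
  exact: (forallP v0 v).
by apply/subsetP => s; rewrite !inE => /andP [].
Qed.

Definition gap_of x : {ffun 'I_n -> 'I_d'.+1} := [ffun v => inord #|gaps x v|.-1].

Lemma gap_ofE x v : injective x -> vacant x 0%R -> (gap_of x v).+1 = #|gaps x v|.
Proof.
move=> injx v0; have /andP [gt le] := gaps_bounds v injx v0.
by rewrite ffunE inordK ?prednK.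
Qed.

Lemma gaps_sub x w v : x w <= x v -> gaps x w \subset gaps x v.
Proof.
move=> le; apply/subsetP => s; rewrite !inE => /andP [lt ->].
by rewrite (leq_trans lt le).
Qed.

(** Induction on the distance between the seats. If the seat after [w] is occupied, its occupant [u]
    has the same gap and properness forces [u < w]; if it is vacant, [v] has a larger gap number. *)
Lemma below_gap_of x w v : shi_proper x -> vacant x 0%R ->
  x w < x v -> below (gap_of x) w v.
Proof.
move=> px v0; have injx := shi_proper_inj px.
have [m] := ubnP (x v - x w); elim: m w => // m IH w lem lt.
have [u Eu | no] := pickP (fun u => x u == (x w).+1 :> nat).
  have Egap : gaps x u = gaps x w.
    apply/setP => s; rewrite !inE (eqP Eu) ltnS leq_eqVlt; apply: andb_id2r => vs.
    case: eqP => //= E; have := forallP vs w.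
    by rewrite -val_eqE /= E eqxx.
  have wu : below (gap_of x) w u.
    rewrite /below; have -> : gap_of x w = gap_of x u.
      by apply/val_inj/succn_inj; rewrite !gap_ofE // Egap.
    rewrite ltnn eqxx /=; case: ltngtP => // [lt'|/val_inj E].
      have [_] := shi_properP _ px _ _ lt'.
      by rewrite Zp_succE ?Eu //; apply: (forallP v0).
    by move: Eu; rewrite E eqn_leq ltnn andbF.
  case: (eqVneq u v) => [<- //|uv]; apply: below_trans wu _.
  have lt' : x u < x v.
    rewrite ltn_neqAle (eqP Eu) lt andbT -(eqP Eu).
    by apply: contraNneq uv => /val_inj /injx ->.
  apply: IH lt'; rewrite -ltnS; apply: leq_trans lem; rewrite ltnS.
  by rewrite (eqP Eu) ltn_sub2l.
have lt2 : (x w).+1 < x v by rewrite ltn_neqAle lt andbT eq_sym no.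
apply/orP; left; rewrite -ltnS !gap_ofE //; apply: proper_card.
apply/properP; split; first exact: gaps_sub (ltnW lt).
have ltq : (x w).+1 < q := ltn_trans lt2 (ltn_ord _).
exists (inord (x w).+1); rewrite inE inordK //.
  rewrite lt2; apply/forallP => u; rewrite -val_eqE /= inordK //.
  by rewrite no.
by rewrite negb_and -leqNgt leqnSn.
Qed.

Lemma gap_ofK x : shi_proper x -> vacant x 0%R -> seat (gap_of x) = x.
Proof.
move=> px v0; have injx := shi_proper_inj px.
apply/ffunP => v; apply: val_inj => /=.
rewrite seatE /seat_nat -addSn gap_ofE // [RHS](seat_gaps v injx); congr (_ + _).
apply: eq_card => w; rewrite !inE; apply/idP/idP => [bw|]; last exact: below_gap_of.
case: ltngtP => // [lt|/val_inj /injx E]; last by rewrite E below_irr in bw.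
have := below_trans bw (below_gap_of px v0 lt).
by rewrite below_irr.
Qed.

Lemma card_shi_vacant0 : #|[set x | shi_proper x && vacant x 0%R]| = d'.+1 ^ n.
Proof.
have -> : [set x | shi_proper x && vacant x 0%R] = [set seat f | f in setT].
  apply/setP => x; rewrite inE; apply/andP/imsetP => [[px v0] | [f _ ->]].
    by exists (gap_of x); rewrite ?gap_ofK.
  by rewrite seat_proper seat_vacant0.
by rewrite (card_imset _ seat_inj) cardsT card_ffun !card_ord.
Qed.

(** Properness is invariant under rotation of the cycle, which moves seat [s] to [0]. *)
Lemma card_shi_vacant (s : 'I_q) :
  #|[set x | shi_proper x && vacant x s]| = d'.+1 ^ n.
Proof.
pose rot (t : 'I_q) x : {ffun 'I_n -> 'I_q} := [ffun v => (x v + t)%R].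
have rot_inj t : injective (rot t).
  by move=> x y /ffunP E; apply/ffunP => v; have := E v; rewrite !ffunE => /addIr.
have rotP t x : shi_proper (rot t x) = shi_proper x.
  apply: eq_forallb => i; apply: eq_forallb => j; rewrite !ffunE.
  by rewrite (inj_eq (addIr t)) addrAC (inj_eq (addIr t)).
rewrite -card_shi_vacant0 -[RHS](card_imset _ (rot_inj s)); apply: eq_card => x.
rewrite inE; apply/andP/imsetP => [[px vs] | [y]].
  exists (rot (- s)%R x); last by apply/ffunP => v; rewrite !ffunE subrK.
  rewrite inE rotP px; apply/forallP => v; rewrite ffunE subr_eq0; exact: (forallP vs).
rewrite inE => /andP [py v0] ->; rewrite rotP; split=> //.
apply/forallP => v; rewrite ffunE -[X in _ != X]add0r (inj_eq (addIr s)); exact: (forallP v0).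
Qed.

(* Double counting of pairs (proper colouring, vacant seat). *)
Lemma card_shi_proper : #|[set x | shi_proper x]| = q * d'.+1 ^ n'.
Proof.
have E : #|[set x | shi_proper x]| * d'.+1 = q * d'.+1 ^ n.
  transitivity (\sum_(x | shi_proper x) \sum_(s | vacant x s) 1).
    rewrite -sum_nat_const; apply: eq_big => [x|x]; rewrite ?inE // => /shi_proper_inj injx.
    by rewrite -(card_vacant injx) sum1dep_card.
  rewrite (exchange_big_dep predT) //= -[q in RHS]card_ord -sum_nat_const.
  by apply: eq_bigr => s _; rewrite -(card_shi_vacant s) sum1dep_card.
by apply/eqP; rewrite -(@eqn_pmul2r d'.+1) // E expnSr mulnA.
Qed.

End Seating.

(** * Forests of the underlying multigraph *)

Section Graph.

Variable n : nat.
Implicit Types (S B C P : {set edge n}) (e f b : edge n) (x y z : 'I_n).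

Definition conn S := connect (adj S).

Lemma joins_endsP e x y :
  reflect (x = etail e /\ y = ehead e \/ x = ehead e /\ y = etail e) (joins e x y).
Proof.
apply: (iffP orP) => [[]/andP [/eqP <- /eqP <-]|[[-> ->]|[-> ->]]].
- by left.
- by right.
- by rewrite !eqxx; left.
by rewrite !eqxx; right.
Qed.

Lemma adj_sym S : symmetric (adj S).
Proof. by move=> x y; apply: eq_existsb => e; rewrite /joins orbC. Qed.

Lemma conn_refl S x : conn S x x.
Proof. exact: connect0. Qed.

Lemma conn_sym S x y : conn S x y = conn S y x.
Proof. exact/sym_connect_sym/adj_sym. Qed.

Lemma conn_trans S : transitive (conn S).
Proof. exact: connect_trans. Qed.

Lemma conn_edge S e : e \in S -> conn S (etail e) (ehead e).
Proof.
move=> eS; apply: connect1; apply/existsP; exists e; rewrite eS /=.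
by apply/joins_endsP; left.
Qed.

Lemma conn_sub S S' x y :
  (forall e, e \in S -> conn S' (etail e) (ehead e)) -> conn S x y -> conn S' x y.
Proof.
move=> sub; apply: connect_sub => {}x {}y /existsP [e /andP [eS]].
by case/joins_endsP=> [[-> ->]|[-> ->]]; last rewrite -/(conn _ _ _) conn_sym; apply: sub.
Qed.

Lemma conn_subset S S' x y : S \subset S' -> conn S x y -> conn S' x y.
Proof. by move=> /subsetP sub; apply: conn_sub => e /sub /conn_edge. Qed.

Lemma conn_setU1 S e x y : conn (e |: S) x y ->
  [\/ conn S x y, conn S x (etail e) /\ conn S (ehead e) y
    | conn S x (ehead e) /\ conn S (etail e) y].
Proof.
case/connectP=> p; elim: p x => [|z p IH] x /=.
  by move=> _ ->; constructor 1; apply: conn_refl.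
case/andP=> /existsP [f /andP [fS jf]] pth Ey; have {IH} := IH z pth Ey.
case/setU1P: fS jf => [->|fS] jf.
  case/joins_endsP: jf => -[-> ->] [xy|[c1 c2]|[c1 c2]].
  - by constructor 2; rewrite conn_refl.
  - by constructor 2; rewrite conn_refl.
  - by constructor 1.
  - by constructor 3; rewrite conn_refl.
  - by constructor 1.
  - by constructor 3; rewrite conn_refl.
have xz : conn S x z.
  have := conn_edge fS; case/joins_endsP: jf => -[-> ->] //.
  by rewrite conn_sym.
case=> [zy|[c1 c2]|[c1 c2]].
- by constructor 1; apply: conn_trans zy.
- by constructor 2; split=> //; apply: conn_trans c1.
by constructor 3; split=> //; apply: conn_trans c1.
Qed.

Lemma is_circleP C : reflect (exists (m : 'I_n) (v : {ffun 'I_m.+2 -> 'I_n})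
    (c : {ffun 'I_m.+2 -> edge n}), circle_walk v c /\ C = [set c t | t : 'I_m.+2])
  (is_circle C).
Proof.
apply: (iffP existsP) => -[m].
  by case/existsP=> v /existsP [c /andP [w /eqP ->]]; exists m, v, c.
case=> v [c [w ->]]; exists m; apply/existsP; exists v; apply/existsP; exists c.
by rewrite w eqxx.
Qed.

Lemma circle_walkP m (v : {ffun 'I_m.+2 -> 'I_n}) (c : {ffun 'I_m.+2 -> edge n}) :
  reflect [/\ injective v, injective c, forall t, valid_edge (c t)
             & forall t, joins (c t) (v t) (v (ordS t))]
          (circle_walk v c).
Proof.
apply: (iffP andP) => [[/andP [/injectiveP vi /injectiveP ci] /forallP H]|[vi ci V J]].
  by split=> // t; case/andP: (H t).
split; first by apply/andP; split; apply/injectiveP.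
by apply/forallP => t; rewrite V J.
Qed.

Lemma circle_valid C e : is_circle C -> e \in C -> valid_edge e.
Proof.
by case/is_circleP=> m [v [c [/circle_walkP [_ _ V _] ->]]] /imsetP [t _ ->].
Qed.

Lemma iter_ordS m (t : 'I_m.+1) k : iter k (@ordS m.+1) t = (t + k) %% m.+1 :> nat.
Proof.
elim: k => [|k IH]; first by rewrite addn0 modn_small.
by rewrite iterS /= IH -addn1 modnDml addn1 addnS.
Qed.

Lemma circle_conn C e : is_circle C -> e \in C -> conn (C :\ e) (etail e) (ehead e).
Proof.
case/is_circleP=> m [v [c [/circle_walkP [vi ci V J] ->]]] /imsetP [t0 _ ->].
set S := _ :\ _.
suff H : conn S (v (ordS t0)) (v t0).
  by case/joins_endsP: (J t0) H => -[-> ->] //; rewrite conn_sym.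
have step t : t != t0 -> conn S (v t) (v (ordS t)).
  move=> tt0; apply: connect1; apply/existsP; exists (c t).
  by rewrite J andbT !inE (inj_eq ci) tt0 imset_f.
apply/negPn/negP => nH.
(* As long as [v t0] is not reached, the walk around the circle avoids the edge [c t0]; yet [m.+1]
   steps from [ordS t0] end at [t0]. *)
have it k : conn S (v (ordS t0)) (v (iter k (@ordS m.+2) (ordS t0))).
  elim: k => [|k IH]; first exact: conn_refl.
  apply: (conn_trans IH); rewrite iterS; apply: step.
  by apply: contraNneq nH => E; rewrite E in IH.
case/negP: nH; have := it m.+1; rewrite -iterSr.
suff -> : iter m.+2 (@ordS m.+2) t0 = t0 by [].
by apply: ord_inj; rewrite iter_ordS modnDr modn_small.
Qed.

(** A repetition-free path in [S] between the ends of [e] is closed up by [e]. *)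
Lemma conn_circle S e : {in S, forall f, valid_edge f} -> valid_edge e -> e \notin S ->
  conn S (etail e) (ehead e) -> exists2 C : {set edge n}, C \subset e |: S & is_circle C.
Proof.
move=> VS Ve eS /connectP [p0 pth0 last0].
have neq : etail e != ehead e by rewrite -val_eqE /= ltn_eqF.
case: (shortenP pth0) last0 => p pth up _ last0 {p0 pth0}.
case: p => [|z p] in pth up last0 *.
  by rewrite /= in last0; rewrite last0 eqxx in neq.
set m := size p; set s := etail e :: z :: p in up.
have szs : size s = m.+2 by [].
have mn : m < n.
  by have := max_card (mem s); rewrite (card_uniqP up) card_ord szs => /ltnW.
have adj_nth t : t < m.+1 -> {f | (f \in S) && joins f (nth (etail e) s t) (nth (etail e) s t.+1)}.
  by move=> lt; have /(pathP (etail e)) /(_ t lt) /existsP /sigW := pth.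
pose v : {ffun 'I_m.+2 -> 'I_n} := [ffun t : 'I_m.+2 => nth (etail e) s t].
pose c : {ffun 'I_m.+2 -> edge n} := [ffun t : 'I_m.+2 =>
  if ltnP t m.+1 is LtnNotGeq lt then sval (adj_nth t lt) else e].
have cP (t : 'I_m.+2) : t < m.+1 ->
    (c t \in S) && joins (c t) (nth (etail e) s t) (nth (etail e) s t.+1).
  move=> lt; rewrite ffunE; case: ltnP => [lt'|]; last by rewrite leqNgt lt.
  exact: (svalP (adj_nth t lt')).
have cmax (t : 'I_m.+2) : t < m.+1 = false -> c t = e.
  by move=> lt; rewrite ffunE; case: ltnP => [lt'|//]; have := lt'; rewrite lt.
have vi : injective v.
  move=> t1 t2; rewrite !ffunE => /eqP; rewrite nth_uniq // => /eqP; exact: val_inj.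
exists [set c t | t : 'I_m.+2].
  apply/subsetP => _ /imsetP [t _ ->]; rewrite inE.
  case lt: (t < m.+1); last by rewrite cmax // set11.
  by case/andP: (cP t lt) => ->; rewrite orbT.
apply/is_circleP; exists (Ordinal mn), v, c; split=> //; apply/circle_walkP; split=> //.
- move=> t1 t2 E.
  case lt1: (t1 < m.+1); case lt2: (t2 < m.+1).
  + have /andP [_ j1] := cP t1 lt1; have /andP [_ j2] := cP t2 lt2.
    have N (a b : nat) : a < m.+2 -> b < m.+2 -> nth (etail e) s a = nth (etail e) s b -> a = b.
      by move=> la lb /eqP; rewrite nth_uniq // => /eqP.
    apply: val_inj => /=; rewrite E in j1.
    (* Equal edges at [t1] and [t2] have the same two ends; matching them in reversed order would
       need both [t1 = t2 + 1] and [t1 + 1 = t2]. *)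
    have cross : nth (etail e) s t1 = nth (etail e) s t2.+1 ->
        nth (etail e) s t1.+1 = nth (etail e) s t2 -> False.
      move=> a1 a2; have F1 : t1 = t2.+1 :> nat by apply: N; rewrite ?ltn_ord.
      have F2 : t1.+1 = t2 by apply: N; rewrite ?ltn_ord.
      by move: F1; rewrite -F2 => /eqP; rewrite eqn_leq [_.+2 <= _]leqNgt leqnSn andbF.
    case/joins_endsP: j1 => -[a1 a2]; case/joins_endsP: j2 => -[b1 b2].
    * by apply: N; rewrite ?ltn_ord // a1 b1.
    * by case: cross; [rewrite a1 b2 | rewrite a2 b1].
    * by case: cross; [rewrite a1 b2 | rewrite a2 b1].
    * by apply: N; rewrite ?ltn_ord // a1 b1.
  + by move: E; rewrite (cmax t2) // => E; case/andP: (cP t1 lt1); rewrite E (negbTE eS).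
  + by move: E; rewrite (cmax t1) // => E; case/andP: (cP t2 lt2); rewrite -E (negbTE eS).
  apply: val_inj => /=.
  have M (t : 'I_m.+2) : t < m.+1 = false -> t = m.+1 :> nat.
    by move/negbT; rewrite -leqNgt => le; apply/eqP; rewrite eqn_leq le andbT -ltnS.
  by rewrite (M t1) // (M t2).
- move=> t; case lt: (t < m.+1); last by rewrite cmax.
  by case/andP: (cP t lt) => /VS.
move=> t; case lt: (t < m.+1).
  have /andP [_] := cP t lt; rewrite !ffunE /=.
  by rewrite modn_small.
rewrite cmax //; apply/joins_endsP; right; rewrite !ffunE /=.
have -> : nat_of_ord t = m.+1.
  by move/negbT: lt; rewrite -leqNgt => le; apply/eqP; rewrite eqn_leq le andbT -ltnS.
by rewrite modnn last0 (last_nth (etail e)).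
Qed.

(** Having no circle means that every edge is a bridge, by [conn_circle] one way and [circle_conn]
    the other. *)
Lemma forestP S :
  reflect ({in S, forall e, valid_edge e} /\
           {in S, forall e, ~~ conn (S :\ e) (etail e) (ehead e)}) (forest S).
Proof.
apply: (iffP andP) => [[/forallP V nC]|[V nC]].
  have VS : {in S, forall e, valid_edge e} by move=> e eS; apply: (implyP (V e)).
  split=> // e eS; apply: contra nC => cn.
  have [||||C sC circC] := @conn_circle (S :\ e) e; rewrite ?setD11 //.
  - by move=> f /setD1P [_ /VS].
  - exact: VS.
  by apply/existsP; exists C; rewrite circC andbT -(setD1K eS).
split; first by apply/forallP => e; apply/implyP => /V.
apply/existsPn => C; apply/negP => /andP [sCS circC].
have [e eC] : exists e, e \in C.
  by case/is_circleP: circC => m [v [c [_ ->]]]; exists (c ord0); apply: imset_f.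
have /negP := nC e (subsetP sCS e eC); apply.
exact: conn_subset (setSD _ sCS) (circle_conn circC eC).
Qed.

Lemma forest_no_circle S C : forest S -> C \subset S -> is_circle C = false.
Proof.
case/andP=> _ /existsPn /(_ C) nC sCS.
by move: nC; rewrite sCS => /negbTE.
Qed.

Lemma forest_subset S S' : S \subset S' -> forest S' -> forest S.
Proof.
move=> sS /forestP [V nC]; apply/forestP; split=> e /(subsetP sS) eS'; first exact: V.
by apply: contra (nC e eS'); apply: conn_subset; apply: setSD.
Qed.

(** A detour around an old edge [e] would have to use [f]; its remainder together with [e] would
    join the ends of [f] in [S]. *)
Lemma forest_setU1 S f : forest S -> valid_edge f -> ~~ conn S (etail f) (ehead f) ->
  forest (f |: S).
Proof.
move=> /forestP [V nC] Vf nf; apply/forestP; split=> e /setU1P [-> //|eS].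
- exact: V.
- apply: contra nf; apply: conn_subset.
  by apply/subsetP => g; rewrite !inE => /andP [/negbTE ->].
apply/negP => cn.
have {cn} : conn (f |: (S :\ e)) (etail e) (ehead e).
  apply: conn_subset cn; apply/subsetP => g; rewrite !inE => /andP [-> /=].
  by [].
have up x y : conn (S :\ e) x y -> conn S x y by apply: conn_subset; apply: subD1set.
have ce := conn_edge eS.
case/conn_setU1=> [|[/up c1 /up c2]|[/up c1 /up c2]]; first exact/negP/nC.
- case/negP: nf; rewrite conn_sym in c1; apply: conn_trans c1 _; apply: conn_trans ce _.
  by rewrite conn_sym.
case/negP: nf; apply: conn_trans c2 _; rewrite conn_sym; apply: conn_trans ce.
by rewrite conn_sym.
Qed.

Lemma spanning_treeP S :
  reflect (forest S /\ forall x y, conn S x y) (spanning_tree S).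
Proof.
apply: (iffP andP) => [[fS /forallP H]|[fS H]]; split=> //.
  by move=> x y; apply: (forallP (H x)).
by apply/forallP => x; apply/forallP => y; apply: H.
Qed.

(** The path of [B] between the ends of [f] must cross [b], so [f] repairs the connection lost with
    [b]. *)
Lemma exchange_spanning_tree B b f : spanning_tree B -> b \in B -> valid_edge f ->
  ~~ conn (B :\ b) (etail f) (ehead f) -> spanning_tree ((B :\ b) :|: [set f]).
Proof.
move=> /spanning_treeP [fB cB] bB Vf nf; rewrite setUC.
have fS : forest (B :\ b) := forest_subset (subD1set _ _) fB.
apply/spanning_treeP; split; first exact: forest_setU1.
set S := B :\ b in nf fS *.
have up x y : conn S x y -> conn (f |: S) x y by apply: conn_subset; apply: subsetUr.
have cf : conn (f |: S) (etail f) (ehead f) by apply/conn_edge/setU11.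
have cb : conn (f |: S) (etail b) (ehead b).
  have := cB (etail f) (ehead f); rewrite -(setD1K bB).
  case/conn_setU1=> [c|[/up c1 /up c2]|[/up c1 /up c2]]; first by rewrite c in nf.
    rewrite conn_sym in c1; apply: conn_trans c1 _; apply: conn_trans cf _.
    by rewrite conn_sym.
  apply: conn_trans c2 _; rewrite conn_sym; apply: conn_trans cf.
  by rewrite conn_sym.
move=> x y; apply: conn_sub (cB x y) => e eB.
case: (eqVneq e b) => [-> //|eb]; apply/up/conn_edge.
by rewrite !inE eb.
Qed.

(** Deleting [e] splits [B'] in two; the path [P] of [B] between the ends of [e], obtained as a
    minimal connecting subset, has an edge [b] passing from one part to the other. *)
Lemma symmetric_exchange B B' e : spanning_tree B -> spanning_tree B' ->
  e \in B' -> e \notin B ->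
  exists b, [/\ b \in B, b \notin B', spanning_tree ((B' :\ e) :|: [set b])
              & spanning_tree ((B :\ b) :|: [set e])].
Proof.
move=> tB tB' eB' eB.
have /spanning_treeP [fB cB] := tB; have /spanning_treeP [fB' cB'] := tB'.
have /forestP [VB nB] := fB; have /forestP [VB' nB'] := fB'.
have [P minP sPB] := minset_exists (P := fun P => conn P (etail e) (ehead e)) (cB _ _).
have cP := minsetp minP.
have [b /andP [bP ncb] | all] :=
    pickP (fun b => (b \in P) && ~~ conn (B' :\ e) (etail b) (ehead b)); last first.
  have /negP := nB' e eB'; case; apply: conn_sub cP => f fP.
  by have := all f; rewrite fP => /negbFE.
have bB := subsetP sPB b bP; exists b; split=> //.
- apply: contra ncb => bB'; apply: conn_edge; rewrite !inE bB' andbT.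
  by apply: contraNneq eB => <-.
- exact: exchange_spanning_tree (VB b bB) ncb.
apply: exchange_spanning_tree (VB' e eB') _ => //.
have up x y : conn (P :\ b) x y -> conn (B :\ b) x y by apply/conn_subset/setSD.
have nPb : ~~ conn (P :\ b) (etail e) (ehead e).
  apply/negP => c; have := minsetinf minP c; rewrite subD1set => /(_ isT) /setP /(_ b).
  by rewrite !inE eqxx bP.
apply: contra (nB b bB) => ce.
move: cP; rewrite -(setD1K bP).
case/conn_setU1=> [c|[/up c1 /up c2]|[/up c1 /up c2]]; first by rewrite c in nPb.
  rewrite conn_sym in c1; apply: conn_trans c1 _; apply: conn_trans ce _.
  by rewrite conn_sym.
apply: conn_trans c2 _; rewrite conn_sym; apply: conn_trans ce.
by rewrite conn_sym.
Qed.

(** A maximal forest will do: two unconnected vertices could be joined by their edge of gain [0]. *)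
Lemma spanning_tree_extension S : forest S ->
  exists2 B : {set edge n}, spanning_tree B & S \subset B.
Proof.
move=> fS; have [B maxB sSB] := maxset_exists (P := @forest n) fS; exists B => //.
have fB := maxsetp maxB; apply/spanning_treeP; split=> //.
have lt_conn x y : x < y -> conn B x y.
  move=> lt; apply/negPn/negP => nc; pose f : edge n := (x, y, false).
  have fU : forest (f |: B) by apply: forest_setU1.
  have /setP/(_ f) := maxsetsup maxB fU (subsetUr _ _).
  rewrite setU11 => /esym /conn_edge; exact/negP.
move=> x y; case: (ltngtP x y) => [/lt_conn //||/val_inj ->]; last exact: conn_refl.
by rewrite conn_sym; apply: lt_conn.
Qed.

End Graph.

(** * Solutions of the gain equations over Z/q *)

Section Colourings.
Local Open Scope ring_scope.

Variables n p : nat.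
Implicit Types (S B C : {set edge n}) (e f : edge n) (x y : {ffun 'I_n -> 'I_p.+2}).

Definition sat x e := x (ehead e) == x (etail e) + (egain e)%:~R.

Definition Sat x := [set e | valid_edge e && sat x e].

Definition Sol S := [set x | S \subset Sat x].

Lemma sat_dgain x e (a b : 'I_n) : valid_edge e -> joins e a b ->
  sat x e = (x b - x a - (dgain e a)%:~R == 0).
Proof.
rewrite /valid_edge -/(etail e) -/(ehead e) /sat /dgain => lt.
case/joins_endsP=> -[-> ->].
  by rewrite eqxx -addrA -opprD subr_eq0.
have -> : (etail e == ehead e) = false by apply/negbTE; rewrite -val_eqE /= ltn_eqF.
by rewrite rmorphN /= opprK addrAC subr_eq0 eq_sym.
Qed.

Lemma sum_ordS m (F : 'I_m.+2 -> 'I_p.+2) : \sum_t (F (ordS t) - F t) = 0.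
Proof. by rewrite sumrB [X in _ - X](reindex_inj (@ordS_inj m.+2)) subrr. Qed.

(** The coordinate differences telescope around the closed walk, leaving the gains. *)
Lemma sum_defect x m (v : {ffun 'I_m.+2 -> 'I_n}) (c : {ffun 'I_m.+2 -> edge n}) :
  \sum_t (x (v (ordS t)) - x (v t) - (dgain (c t) (v t))%:~R)
  = - (\sum_t dgain (c t) (v t))%:~R.
Proof. by rewrite sumrB (sum_ordS (fun t => x (v t))) sub0r [in RHS]rmorph_sum. Qed.

Lemma balanced_circleP C : reflect (exists (m : 'I_n) (v : {ffun 'I_m.+2 -> 'I_n})
    (c : {ffun 'I_m.+2 -> edge n}), [/\ circle_walk v c, C = [set c t | t : 'I_m.+2]
      & \sum_t dgain (c t) (v t) = 0])
  (balanced_circle C).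
Proof.
apply: (iffP existsP) => -[m].
  by case/existsP=> v /existsP [c /and3P [w /eqP -> /eqP E]]; exists m, v, c.
case=> v [c [w -> E]]; exists m; apply/existsP; exists v; apply/existsP; exists c.
by rewrite w E !eqxx.
Qed.

Lemma balanced_is_circle C : balanced_circle C -> is_circle C.
Proof.
by case/balanced_circleP=> m [v [c [w -> _]]]; apply/is_circleP; exists m, v, c.
Qed.

(** The defects along a balanced circle add up to zero, so when all but one vanish the last one does
    too. *)
Lemma balanced_sat x C e : balanced_circle C -> e \in C ->
  {in C :\ e, forall f, sat x f} -> sat x e.
Proof.
case/balanced_circleP=> m [v [c [/circle_walkP [vi ci V J] -> sum0]]].
case/imsetP=> t0 _ -> satC; rewrite (sat_dgain x (V t0) (J t0)).
have := sum_defect x v c; rewrite sum0 mulr0z oppr0 (bigD1 t0) //=.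
rewrite big1 ?addr0 => [->|t tt0]; first by rewrite eqxx.
apply/eqP; rewrite -(sat_dgain x (V t) (J t)); apply: satC.
by rewrite !inE (inj_eq ci) tt0 imset_f.
Qed.

Lemma Zp_int_eq0 (z : int) : (`|z| < p.+2)%N -> (z%:~R : 'I_p.+2) = 0 -> z = 0.
Proof.
have nat0 k : (k < p.+2)%N -> (k%:R : 'I_p.+2) = 0 -> k = 0%N.
  move=> lt; rewrite Zp_nat => /(congr1 val) /=.
  by rewrite modn_small.
case: z => k /= lt.
  by rewrite -pmulrn => /(nat0 _ lt) ->.
rewrite NegzE rmorphN /= -pmulrn => /eqP; rewrite oppr_eq0 => /eqP /(nat0 _ lt).
by [].
Qed.

(** The gain sum vanishes modulo [p.+2], and its absolute value is at most the length of the circle,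
    hence at most [n]. *)
Lemma circle_sat_balanced x C : (n < p.+2)%N -> is_circle C ->
  {in C, forall f, sat x f} -> balanced_circle C.
Proof.
move=> ltn /is_circleP [m [v [c [w EC]]]] satC.
apply/balanced_circleP; exists m, v, c; split=> //.
have /circle_walkP [vi ci V J] := w.
apply: Zp_int_eq0.
  apply: leq_ltn_trans ltn.
  have : `|\sum_t dgain (c t) (v t)| <= \sum_(t < m.+2) (1 : int).
    apply: le_trans (ler_norm_sum _ _ _) _; apply: ler_sum => t _.
    by rewrite /dgain /egain; case: ifP => _; rewrite ?normrN; case: (_.2).
  rewrite sumr_const card_ord -abszE => le.
  have {le} : (`|(\sum_t dgain (c t) (v t))%R| <= m.+2)%N.
    by rewrite -lez_nat; apply: le_trans le _; rewrite pmulrn intz.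
  move/leq_trans; apply.
  by have := leq_card v vi; rewrite !card_ord.
apply/eqP; rewrite -oppr_eq0 -(sum_defect x) big1 // => t _; apply/eqP.
by rewrite -(sat_dgain x (V t) (J t)); apply: satC; rewrite EC imset_f.
Qed.

Lemma SatP x e : valid_edge e -> (e \in Sat x) = sat x e.
Proof. by rewrite inE => ->. Qed.

Lemma Sat_shift x S (K : {set 'I_n}) (a : 'I_p.+2) :
  {in S, forall e, (etail e \in K) = (ehead e \in K)} ->
  S \subset Sat x ->
  S \subset Sat [ffun v => if v \in K then x v + a else x v].
Proof.
move=> inK sS; apply/subsetP => e eS; have := subsetP sS e eS; rewrite !inE => /andP [-> /=].
by rewrite /sat !ffunE (inK e eS); case: ifP => _ //; rewrite addrAC (inj_eq (addIr a)).
Qed.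

(** Induction by deleting an edge [e]: the difference along [e] takes each of its [p.+2] values
    equally often on [Sol (S :\ e)], and one of the fibres is [Sol S]. *)
Lemma card_Sol S : forest S -> (#|Sol S| * p.+2 ^ #|S| = p.+2 ^ n)%N.
Proof.
have [m] := ubnP #|S|; elim: m S => // m IH S; rewrite ltnS => leS fS.
have [->|[e eS]] := set_0Vmem S.
  rewrite cards0 muln1 (eq_card (B := {: {ffun 'I_n -> 'I_p.+2}})).
    by rewrite card_ffun !card_ord.
  by move=> x; rewrite !inE sub0set.
have cS : #|S| = #|S :\ e|.+1 by rewrite (cardsD1 e) eS.
have fS' : forest (S :\ e) := forest_subset (subD1set _ _) fS.
have /forestP [VS nS] := fS; have nc := nS e eS.
pose fib a := [set x in Sol (S :\ e) | x (ehead e) - x (etail e) == a].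
have fib_le a b : (#|fib a| <= #|fib b|)%N.
  (* Shifting the component of the head of [e], which does not contain the tail, injects one fibre
     into another. *)
  pose K := [set v | conn (S :\ e) (ehead e) v].
  pose sh x : {ffun 'I_n -> 'I_p.+2} := [ffun v => if v \in K then x v + (b - a) else x v].
  have sh_inj : injective sh.
    move=> x y /ffunP E; apply/ffunP => v; have := E v; rewrite !ffunE.
    by case: ifP => // _ /addIr.
  rewrite -(card_imset _ sh_inj); apply: subset_leq_card; apply/subsetP => _ /imsetP [x xa ->].
  move: xa; rewrite !inE => /andP [sx /eqP xa]; apply/andP; split.
    apply: Sat_shift sx => f fS2; rewrite !inE.
    have cf := conn_edge fS2; apply/idP/idP => c; first exact: conn_trans cf.
    by apply: conn_trans c _; rewrite conn_sym.
  by rewrite !ffunE !inE conn_refl conn_sym (negbTE nc) addrAC xa addrC subrK.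
have fibE a : #|fib a| = #|Sol S|.
  transitivity #|fib (egain e)%:~R|; first by apply/eqP; rewrite eqn_leq !fib_le.
  apply: eq_card => x; rewrite !inE -[in RHS](setD1K eS) subUset sub1set SatP ?VS //.
  by rewrite andbC /sat subr_eq [in RHS]addrC.
have sumS : #|Sol (S :\ e)| = (p.+2 * #|Sol S|)%N.
  rewrite -[X in (X * _)%N]card_ord -sum_nat_const -sum1_card.
  rewrite (partition_big (fun x : {ffun 'I_n -> 'I_p.+2} => x (ehead e) - x (etail e)) predT) //=.
  by apply: eq_bigr => a _; rewrite -(fibE a) -sum1dep_card; apply: eq_bigl => x; rewrite !inE.
by rewrite cS expnS mulnA [(_ * p.+2)%N]mulnC -sumS IH // -cS.
Qed.

(** [Sol S] is nonempty and closed under translation, so it has at least [p.+2] elements; [card_Sol]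
    then bounds [#|S|]. *)
Lemma forest_card_lt S : (0 < n)%N -> forest S -> (#|S| < n)%N.
Proof.
move=> n_gt0 fS; have E := card_Sol fS.
have /card_gt0P [x xS] : (0 < #|Sol S|)%N.
  by rewrite lt0n; apply/eqP => E0; move/eqP: E; rewrite E0 mul0n eq_sym expn_eq0.
pose sh a : {ffun 'I_n -> 'I_p.+2} := [ffun v => if v \in [set: 'I_n] then x v + a else x v].
have sh_inj : injective sh.
  by move=> a b /ffunP /(_ (Ordinal n_gt0)); rewrite !ffunE inE => /addrI.
rewrite -(@leq_exp2l p.+2) // -E expnS leq_mul2r; apply/orP; right.
rewrite -[X in (X <= _)%N]card_ord -(card_imset _ sh_inj); apply: subset_leq_card.
apply/subsetP => _ /imsetP [a _ ->]; rewrite inE; apply: Sat_shift; last by rewrite inE in xS.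
by move=> e _; rewrite !inE.
Qed.

End Colourings.

(** For the lower bound: over Z/2, connectedness lets the value at one vertex determine a solution,
    so [Sol 0 S] has at most two elements. *)
Lemma card_spanning_tree n (S : {set edge n}) : 0 < n -> spanning_tree S -> #|S| = n.-1.
Proof.
move=> n_gt0 /spanning_treeP [fS cS].
apply/eqP; rewrite -eqSS prednK // eqn_leq (@forest_card_lt _ 0) //=.
have E := card_Sol 0 fS.
rewrite -(@leq_exp2l 2) // -E expnS leq_mul2r; apply/orP; right.
rewrite -[X in _ <= X]card_ord.
have inj : {in Sol 0 S &, injective (fun x : {ffun 'I_n -> 'I_2} => x (Ordinal n_gt0))}.
  move=> x y; rewrite !inE => sx sy E0; apply/ffunP => v.
  case/connectP: (cS (Ordinal n_gt0) v) => r; move: (Ordinal n_gt0) E0.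
  elim: r => [|z r IH] u Eu /=; first by move=> _ ->.
  case/andP=> /existsP [e /andP [eS j]]; apply: IH.
  have := subsetP sx e eS; have := subsetP sy e eS; rewrite !inE.
  case/andP=> _ /eqP s1 /andP [_ /eqP s2].
  case/joins_endsP: j Eu => -[-> ->]; first by rewrite s1 s2 => ->.
  by rewrite s1 s2 => /addIr.
by rewrite -(card_in_imset inj) max_card.
Qed.

(** * NBC sets and activity *)

Section NBC.

Variables (n : nat) (ord : edge n -> nat).
Hypothesis ord_inj : injective ord.
Implicit Types (S B C A : {set edge n}) (e f b : edge n).

Lemma nbc_setP S : reflect
  (forest S /\ forall C e, balanced_circle C -> e \in C ->
     {in C, forall f, ord e <= ord f} -> ~~ (C :\ e \subset S))
  (nbc_set ord S).
Proof.
apply: (iffP andP) => [[fS /existsPn nB]|[fS nB]]; split=> //.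
  move=> C e bC eC minC; have := nB (C :\ e); apply: contra => ->; rewrite andbT.
  apply/existsP; exists C; rewrite bC; apply/existsP; exists e; rewrite eC eqxx andbT.
  by apply/forallP => f; apply/implyP; apply: minC.
apply/existsPn => D; apply/negP => /andP [/existsP [C /andP [bC]]].
case/existsP=> e /and3P [eC /forallP minC /eqP ->] sS.
case/negP: (nB C e bC eC (fun f fC => implyP (minC f) fC)); exact: sS.
Qed.

Lemma nbc_subset S S' : S \subset S' -> nbc_set ord S' -> nbc_set ord S.
Proof.
move=> sS /nbc_setP [fS' nB]; apply/nbc_setP; split; first exact: forest_subset fS'.
move=> C e bC eC minC; apply: contra (nB C e bC eC minC) => sC.
exact: subset_trans sS.
Qed.

Lemma nbc_set0 : nbc_set ord set0.
Proof.
apply/nbc_setP; split; first by apply/forestP; split=> e; rewrite inE.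
move=> C e bC eC _; rewrite subset0; apply/negP => /eqP E.
have circC := balanced_is_circle bC.
have := circle_conn circC eC; rewrite E => /connectP [[|z r]] /=.
  have := circle_valid circC eC; rewrite /valid_edge -/(etail e) -/(ehead e).
  by move=> lt _ Ee; rewrite Ee ltnn in lt.
by case/andP=> /existsP [f]; rewrite inE.
Qed.

(* The NBC sets of hyperplanes through a fixed point [x] form a cone whose apex
   is the smallest of these hyperplanes. *)
Lemma nbc_cone p (x : {ffun 'I_n -> 'I_p.+2}) e0 S : n < p.+2 ->
  e0 \in Sat x -> {in Sat x, forall f, ord e0 <= ord f} ->
  S \subset Sat x -> nbc_set ord S -> nbc_set ord (e0 |: S).
Proof.
move=> ltn e0x min0 sSx /nbc_setP [fS nB].
have sUx : e0 |: S \subset Sat x by rewrite subUset sub1set e0x.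
have satx f : f \in Sat x -> sat x f by rewrite inE => /andP [].
apply/nbc_setP; split.
  apply/andP; split.
    by apply/forallP => f; apply/implyP => /(subsetP sUx); rewrite inE => /andP [].
  apply/existsPn => C; apply/negP => /andP [sC circC].
  have sCx := subset_trans sC sUx.
  (* A circle through [x] is balanced, and it contains [e0] since [S] is a forest; without [e0] it
     is a broken circuit inside [S]. *)
  have bC : balanced_circle C.
    by apply: circle_sat_balanced ltn circC _ => f /(subsetP sCx) /satx; apply.
  have e0C : e0 \in C.
    apply/negPn/negP => n0; have := forest_no_circle fS (C := C); rewrite circC.
    move=> H; apply: notF; rewrite -H //; apply/subsetP => f fC.
    have := subsetP sC f fC; rewrite !inE; case: eqP => // E.
    by rewrite -E fC in n0.
  have /negP := nB C e0 bC e0C (fun f fC => min0 f (subsetP sCx f fC)); case.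
  by rewrite subDset.
move=> C e bC eC minC; apply/negP => sC.
(* The missing edge [e] of a broken circuit also passes through [x]. If the broken circuit contained
   [e0], minimality on both sides would give [e = e0]. *)
have ex : e \in Sat x.
  rewrite inE (circle_valid (balanced_is_circle bC) eC) /=.
  by apply: (balanced_sat bC eC) => f /(subsetP sC) /(subsetP sUx) /satx.
have /negP := nB C e bC eC minC; case; apply/subsetP => f fC.
have := subsetP sC f fC; rewrite inE => /orP [/set1P Ef|//].
have le1 := min0 e ex; have le2 : ord e <= ord e0.
  by apply: minC; rewrite -Ef; case/setD1P: fC.
have E : e = e0 by apply: ord_inj; apply/eqP; rewrite eqn_leq le2 le1.
by case/setD1P: fC; rewrite Ef E eqxx.
Qed.

Local Open Scope ring_scope.

(** By [nbc_cone], toggling the smallest hyperplane through [x] is a sign-reversing involution; when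
    there is none, only the empty set contributes. *)
Lemma nbc_alternating p (x : {ffun 'I_n -> 'I_p.+2}) : (n < p.+2)%N ->
  \sum_(S : {set edge n} | nbc_set ord S && (S \subset Sat x)) (-1) ^+ #|S|
  = (Sat x == set0)%:R :> int.
Proof.
move=> ltn; case: (set_0Vmem (Sat x)) => [->|[e1 e1x]].
  rewrite eqxx (big_pred1 set0) ?cards0 //= => S; rewrite subset0 /=.
  by case: eqP => [->|]; rewrite ?nbc_set0 ?andbF.
have -> : (Sat x == set0) = false by apply/negbTE/set0Pn; exists e1.
case: (arg_minnP ord e1x) => e0 e0x0 min0; have e0x : e0 \in Sat x := e0x0.
pose tog S := if e0 \in S then S :\ e0 else e0 |: S.
have togK : involutive tog.
  move=> S; case e0S: (e0 \in S); rewrite /tog e0S; first by rewrite setD11 setD1K.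
  by rewrite setU11 setU1K ?e0S.
have togP S : nbc_set ord S && (S \subset Sat x) ->
              nbc_set ord (tog S) && (tog S \subset Sat x).
  case/andP=> nS sS; rewrite /tog; case: ifPn => e0S.
    by rewrite (nbc_subset (subD1set _ _) nS) (subset_trans (subD1set _ _)).
  by rewrite (nbc_cone ltn e0x min0 sS nS) subUset sub1set e0x.
have togS S : (-1) ^+ #|tog S| = - (-1) ^+ #|S| :> int.
  rewrite /tog; case: ifPn => e0S; last by rewrite cardsU1 e0S exprS mulN1r.
  by rewrite [in RHS](cardsD1 e0) e0S exprS mulN1r opprK.
set s := \sum_(S | _) _; have : s = - s.
  rewrite {1}/s (reindex_inj (inv_inj togK)) /= -sumrN; apply: eq_big => // S.
  by apply/idP/idP => /togP; rewrite ?togK.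
by move/eqP; rewrite -addr_eq0 -mulr2n mulrn_eq0 => /eqP.
Qed.

(** Whitney's theorem: a signed count of pairs of an NBC set and a point on all its hyperplanes,
    with the sum over sets evaluated first. *)
Lemma nbc_Sol p : (n < p.+2)%N ->
  \sum_(S : {set edge n} | nbc_set ord S) (-1) ^+ #|S| * #|Sol p S|%:R
  = #|[set x : {ffun 'I_n -> 'I_p.+2} | Sat x == set0]|%:R :> int.
Proof.
move=> ltn; rewrite -sum1dep_card natr_sum [RHS]big_mkcond /=.
under [RHS]eq_bigr => x _ do rewrite -mulrb -(nbc_alternating x ltn) big_mkcondr /=.
rewrite exchange_big /=; apply: eq_bigr => S _.
rewrite -big_mkcond /= sumr_const mulr_natr; congr (_ *+ _).
by apply: eq_card => x; rewrite !inE.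
Qed.

Local Open Scope nat_scope.

Lemma activeP B e : reflect
  (e \in B /\ forall f, valid_edge f -> spanning_tree ((B :\ e) :|: [set f]) ->
     ord e <= ord f)
  (active ord B e).
Proof.
apply: (iffP andP) => [[eB /forallP H]|[eB H]]; split=> //.
  by move=> f Vf tf; apply: (implyP (H f)); rewrite Vf.
by apply/forallP => f; apply/implyP => /andP [Vf tf]; apply: H.
Qed.

(** [B] minimises the total of [ord] among spanning trees containing [S]; exchanging an edge outside
    [S] keeps [S] inside the tree and so cannot lower this total. *)
Lemma min_tree S : forest S ->
  exists2 B : {set edge n}, spanning_tree B /\ S \subset B
    & {in B :\: S, forall e, active ord B e}.
Proof.
case/spanning_tree_extension=> B0 tB0 sB0.
pose P B := spanning_tree B && (S \subset B).
have PB0 : P B0 by rewrite /P tB0.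
case: (arg_minnP (fun B : {set edge n} => \sum_(e in B) ord e) PB0) => B /andP [tB sSB] minB.
exists B => // b /setDP [bB bS]; apply/activeP; split=> // f Vf tf.
have /spanning_treeP [/forestP [VB nB] _] := tB.
(* Otherwise the exchanged tree would be [B :\ b], although [b] is a bridge of [B]. *)
have fB : f \notin B :\ b.
  apply/negP => fB; have := nB b bB.
  have /spanning_treeP [_ c] := tf; move: c; rewrite setUC.
  have -> : f |: (B :\ b) = B :\ b by apply/setUidPr; rewrite sub1set.
  by move=> ->.
have := minB ((B :\ b) :|: [set f]); rewrite /P tf /= => /(_ _) H.
have : \sum_(e in B) ord e <= \sum_(e in B :\ b :|: [set f]) ord e.
  apply: H; apply/subsetP => e eS; rewrite !inE (subsetP sSB) // andbT.
  by case: eqP => // E; rewrite -E eS in bS.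
rewrite setUC big_setU1 //= (big_setD1 b bB) /=.
by rewrite leq_add2r.
Qed.

(** A broken circuit [C :\ e] in [B] has an edge [b] outside [S], which is active. Exchanging [b]
    for [e] keeps a spanning tree, so [ord b <= ord e], against the choice of [e] as smallest in
    [C]. *)
Lemma min_tree_nbc S B : nbc_set ord S -> spanning_tree B ->
  {in B :\: S, forall e, active ord B e} -> nbc_set ord B.
Proof.
move=> /nbc_setP [fS nS] tB act.
have /spanning_treeP [fB cB] := tB; have /forestP [VB nB] := fB.
apply/nbc_setP; split=> // C e balC eC minC; apply/negP => sCB.
have /subsetPn [b bCe bS] := nS C e balC eC minC.
have /setD1P [be bC] := bCe.
have circC := balanced_is_circle balC.
have bB := subsetP sCB b bCe.
have /activeP [_ actb] : active ord B b by apply: act; rewrite inE bS.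
have le : ord b <= ord e.
  apply: actb (circle_valid circC eC) _.
  apply: (exchange_spanning_tree tB bB (circle_valid circC eC)).
  apply: contra (nB b bB) => ce.
  apply: conn_sub (circle_conn circC bC) => f /setD1P [fb fC].
  case: (eqVneq f e) => [-> //|fe]; apply: conn_edge.
  by rewrite in_setD1 fb (subsetP sCB) // in_setD1 fe.
by case/eqP: be; apply: ord_inj; apply/eqP; rewrite eqn_leq le minC.
Qed.

(** If [e] is in [B'] but not in [B], a symmetric exchange yields [b]; activity of [e] in [B'] and
    of [b] in [B] gives inequalities both ways, so [e = b]. *)
Lemma min_tree_unique S B B' :
  spanning_tree B -> spanning_tree B' -> S \subset B -> S \subset B' ->
  {in B :\: S, forall e, active ord B e} -> {in B' :\: S, forall e, active ord B' e} ->
  B' \subset B.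
Proof.
move=> tB tB' sB sB' act act'; apply/subsetP => e eB'; apply/negPn/negP => eB.
have [b [bB bB' t1 t2]] := symmetric_exchange tB tB' eB' eB.
have valid D f : spanning_tree D -> f \in D -> valid_edge f.
  by case/spanning_treeP=> /forestP [V _] _; apply: V.
have /activeP [_ /(_ b) a1] : active ord B' e.
  by apply: act'; rewrite inE eB' andbT; apply: contra eB; apply: (subsetP sB).
have /activeP [_ /(_ e) a2] : active ord B b.
  by apply: act; rewrite inE bB andbT; apply: contra bB'; apply: (subsetP sB').
case/negP: eB; suff -> : e = b by [].
apply: ord_inj; apply/eqP; rewrite eqn_leq a1 ?a2 //; [exact: valid eB'|exact: valid bB].
Qed.

(** The right-hand side is a boolean read as a number: an NBC set comes from exactly one basis, its
    minimal tree, and any other set from none. *)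
Lemma card_min_tree S :
  #|[set B | nbc_basis ord B && ((S \subset B) && (B :\: S \subset [set e | active ord B e]))]|
  = nbc_set ord S.
Proof.
case: (boolP (nbc_set ord S)) => nS; last first.
  apply/eqP; rewrite cards_eq0; apply/eqP/setP => B; rewrite !inE; apply/negP.
  by case/and3P=> /andP [nB _] sB _; rewrite (nbc_subset sB nB) in nS.
have /nbc_setP [fS _] := nS.
have [B [tB sB] act] := min_tree fS.
rewrite (_ : [set _ | _] = [set B]) ?cards1 //; apply/setP => B'; rewrite !inE.
apply/idP/eqP => [/and3P [/andP [_ tB'] sB' /subsetP act']| ->]; last first.
  rewrite /nbc_basis tB (min_tree_nbc nS tB act) sB /=.
  by apply/subsetP => e /act; rewrite inE.
have act2 : {in B' :\: S, forall e, active ord B' e} by move=> e /act'; rewrite inE.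
apply/eqP; rewrite eqEsubset (min_tree_unique tB tB' sB sB' act act2).
exact: (min_tree_unique tB' tB sB' sB act2 act).
Qed.

Local Open Scope ring_scope.

Lemma nbc_basis_activity : (0 < n)%N ->
  \sum_(B : {set edge n} | nbc_basis ord B) ('X + 1) ^+ activity ord B
  = \sum_(S : {set edge n} | nbc_set ord S) 'X^(n.-1 - #|S|) :> {poly int}.
Proof.
move=> n_gt0.
transitivity (\sum_(B : {set edge n} | nbc_basis ord B)
    \sum_(S : {set edge n} | (S \subset B) && (B :\: S \subset [set e | active ord B e]))
      'X^(n.-1 - #|S|) : {poly int}).
  apply: eq_bigr => B /andP [nB tB]; rewrite /activity -sum_Xn_subset.
  have subB : [set e | active ord B e] \subset B.
    by apply/subsetP => e; rewrite inE => /activeP [].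
  have DK (D : {set edge n}) : D \subset B -> B :\: (B :\: D) = D.
    by move=> sD; rewrite setDDr setDv set0U; apply/setIidPr.
  (* Complementation in [B] exchanges a set [A] of active edges with the NBC set [S] left after
     removing it. *)
  rewrite (reindex_onto (fun S => B :\: S) (fun S => B :\: S)) /=; last first.
    by move=> A sA; apply: DK; apply: subset_trans sA subB.
  apply: eq_big => [S|S].
    rewrite andbC; apply: andb_id2r => _; apply/eqP/idP => [<-|]; first exact: subsetDl.
    exact: DK.
  case/andP=> _ /eqP E; have sS : S \subset B by rewrite -E subsetDl.
  by rewrite cardsDS // (card_spanning_tree n_gt0 tB).
rewrite (exchange_big_dep predT) //= [RHS]big_mkcond; apply: eq_bigr => S _.
rewrite sumr_const (eq_card (B := [set B | nbc_basis ord B && ((S \subset B)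
   && (B :\: S \subset [set e | active ord B e]))])); last by move=> B; rewrite inE.
by rewrite card_min_tree mulrb.
Qed.

End NBC.

(** * The NBC polynomial and the final comparison *)

Lemma Sat_shi_proper (n' d' : nat) (x : {ffun 'I_n'.+1 -> 'I_(n' + d').+2}) :
  (Sat x == set0) = shi_proper x.
Proof.
apply/eqP/shi_properP => [S0 i j lt|px].
  have H g : (i, j, g) \notin Sat x by rewrite S0 inE.
  move: (H false) (H true); rewrite !inE /valid_edge lt /sat /=.
  by rewrite /egain /= addr0.
apply/setP => -[[i j] g]; rewrite !inE /valid_edge /sat /egain /=.
apply/negP => /andP [/px [/negP n0 /negP n1]].
by case: g => /=; rewrite ?addr0.
Qed.

Lemma nbc_poly (n' : nat) (ord : edge n'.+1 -> nat) : injective ord ->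
  (\sum_(S : {set edge n'.+1} | nbc_set ord S) 'X^(n' - #|S|)
  = ('X + n'.+1%:R) ^+ n' :> {poly int})%R.
Proof.
move=> ord_inj; apply: (@poly_eq_nat_evals _ _ n'.+2) => m lem.
(* [m] is the number of colours; from [n'.+2] on it exceeds the number of vertices, as [nbc_Sol]
   requires, and leaves [d'.+1] seats vacant. *)
have [d' Em] : exists d', m = (n' + d').+2.
  by exists (m - n'.+2); rewrite -[in LHS](subnKC lem) !addSn.
rewrite horner_exp hornerD hornerX -polyC_natr hornerC.
rewrite horner_sum; under eq_bigr => S _ do rewrite hornerXn.
have ltn : n'.+1 < (n' + d').+2 by rewrite ltnS ltnS leq_addr.
have E : (\sum_(S : {set edge n'.+1} | nbc_set ord S) (-1) ^+ #|S| * #|Sol (n' + d') S|%:R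
    = (m * d'.+1 ^ n')%:R :> int)%R.
  rewrite (nbc_Sol ord_inj ltn) Em -card_shi_proper; congr (_%:R)%R.
  by apply: eq_card => x; rewrite !inE Sat_shi_proper.
have m0 : (m%:R != 0 :> int)%R by rewrite Em pnatr_eq0.
(* The extra factor [m] turns each term into, up to sign, the number [m ^ (n'.+1 - #|S|)] of
   solutions of [S]. *)
apply: (mulfI m0); transitivity ((-1) ^+ n' * (m * d'.+1 ^ n')%:R : int)%R; last first.
  have -> : (- m%:R + n'.+1%:R = - d'.+1%:R :> int)%R.
    by rewrite Em -addSn -addnS natrD opprD addrAC addNr add0r.
  by rewrite [in RHS]exprNn -natrX natrM mulrCA.
rewrite -E !mulr_sumr; apply: eq_bigr => S /nbc_setP [fS _].
have leS : #|S| <= n' by rewrite -ltnS (@forest_card_lt _ 0).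
have cS : #|Sol (n' + d') S| = m ^ (n'.+1 - #|S|).
  apply/eqP; rewrite -(@eqn_pmul2r (m ^ #|S|)) ?expn_gt0 ?Em // card_Sol //.
  by rewrite -expnD subnK // leqW.
have sgn : ((-1) ^+ (n' - #|S|) = (-1) ^+ n' * (-1) ^+ #|S| :> int)%R.
  move: #|S| leS => s les.
  by rewrite -[in RHS](subnK les) exprD -mulrA -expr2 sqrr_sign mulr1.
by rewrite cS subSn // expnS natrM natrX [in LHS]exprNn sgn -!mulrA mulrCA [in LHS](mulrCA m%:R%R).
Qed.

Theorem theorem5p2 (n k : nat) (ord : edge n -> nat) :
  (2 <= n)%N -> (k <= n - 1)%N -> injective ord ->
  let N0 := #|[set B : {set edge n} | nbc_basis ord B && (activity ord B == k)]| in
  let N1 := #|[set rp : 'I_n * {ffun 'I_n -> 'I_n} | rooted_tree rp.1 rp.2 &&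
               (#|[set e in rtree_edges rp.1 rp.2 | val e.1 == n.-1]| == k)]| in
  let N2 := #|[set rp : 'I_n * {ffun 'I_n -> 'I_n} | rooted_tree rp.1 rp.2 &&
               (#|[set e in rtree_edges rp.1 rp.2 | val e.1 == (val e.2).+1]| == k)]| in
  [/\ N0 = N1, N1 = N2 & N2 = 'C(n - 1, k) * (n - 1) ^ (n - 1 - k)].
Proof.
case: n ord => // n' ord _ lek ord_inj N0 N1 N2; rewrite subn1 in lek *.
have E0 : N0 = 'C(n', k) * n' ^ (n' - k).
  by apply: card_statistic => //; rewrite nbc_basis_activity // nbc_poly.
have E1 : N1 = 'C(n', k) * n' ^ (n' - k).
  apply: (card_rooted_tree_common_edges (rtree_star n') lek (Q := fun e => val e.1 == n')).
  move=> p v pv; rewrite ffunE /= -[LHS]/(p == ord_max).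
  by case: eqP => [E|]; rewrite ?andbF // -E pv.
have E2 : N2 = 'C(n', k) * n' ^ (n' - k).
  apply: (card_rooted_tree_common_edges (rtree_path n') lek
           (Q := fun e => val e.1 == (val e.2).+1)).
  move=> p v pv; rewrite ffunE /=; set w := inord _.
  have Ew : w = minn v.+1 n' :> nat by rewrite inordK // ltnS geq_minr.
  (* At the last vertex [w] is [v] itself, and both sides fail. *)
  apply/eqP/andP => [Ep | [wv /eqP Ep]].
    have /minn_idPl Em : v.+1 <= n' by rewrite -Ep -ltnS.
    by rewrite -!val_eqE /= Ew Em Ep eqxx gtn_eqF.
  rewrite Ep Ew; apply/minn_idPl; move: wv; rewrite -val_eqE /= Ew.
  have := ltn_ord v; rewrite ltnS; case: ltngtP => // -> _.
  by rewrite (minn_idPr (leqnSn n')) eqxx.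
by rewrite E0 E1 E2.
Qed.
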